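(* For $n\ge1$ the following identities hold: $$\sum_{\sigma\in\mathfrak{S}_n}(-1)^{\mathrm{inv}(\sigma)}x^{\mathrm{exc}(\sigma)}h^{\mathrm{depth}(\sigma)}=(1-xh)^{n-1},$$ $$\sum_{\sigma\in\mathfrak{S}_n}(-1)^{\mathrm{nest}(\sigma)}x^{\mathrm{exc}(\sigma)}h^{\mathrm{depth}(\sigma)}=(1+xh)^{n-1},$$ $$\sum_{\sigma\in\mathfrak{S}_n}(-1)^{\mathrm{rmin}(\sigma)}x^{\mathrm{exc}(\sigma)}h^{\mathrm{depth}(\sigma)}=(-1)^n(1-xh)^{n-1},$$ $$\sum_{\sigma\in\mathfrak{S}_n}(-1)^{\mathrm{lmax}(\sigma)}h^{\mathrm{depth}(\sigma)}=(-1)^n(1-h)^{n-1}.$$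
   Context: For $\sigma\in\mathfrak{S}_n$ (permutations of $[n]$, $\sigma_i=\sigma(i)$): $\mathrm{exc}(\sigma)=\#\{i:\sigma(i)>i\}$, $\mathrm{inv}(\sigma)=\#\{i<j:\sigma_i>\sigma_j\}$, $\mathrm{depth}(\sigma)=\sum_{\sigma(i)>i}(\sigma(i)-i)$, $\mathrm{lmax}(\sigma)$ is the number of letters larger than all letters to their left, $\mathrm{rmin}(\sigma)$ is the number of letters smaller than all letters to their right, and $$\mathrm{nest}(\sigma)=\#\{(i,j)\in[n]^2:(i<j\le\sigma_j<\sigma_i)\lor(i>j>\sigma_j>\sigma_i)\}.$$ *)

(* Defs.v *)
From mathcomp Require Import all_boot all_algebra all_fingroup.

Set Implicit Arguments.
Unset Strict Implicit.
Unset Printing Implicit Defensive.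

(* A permutation of {1, ..., n} is an element of 'S_n, which acts on
   {0, ..., n - 1}. All statistics below only compare or subtract positions and
   letters, so they are invariant under this shift. *)

Definition exc (n : nat) (s : 'S_n) : nat := #|[set i : 'I_n | i < s i]|.

Definition inversions (n : nat) (s : 'S_n) : nat :=
  #|[set p : 'I_n * 'I_n | (p.1 < p.2) && (s p.2 < s p.1)]|.

Definition depth (n : nat) (s : 'S_n) : nat := \sum_(i < n | i < s i) (s i - i).

(* In lmax and rmin a letter is identified with the position i where it
   occurs. *)

Definition lmax (n : nat) (s : 'S_n) : nat :=
  #|[set i : 'I_n | [forall j : 'I_n, (j < i) ==> (s j < s i)]]|.

Definition rmin (n : nat) (s : 'S_n) : nat :=
  #|[set i : 'I_n | [forall j : 'I_n, (i < j) ==> (s i < s j)]]|.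

Definition nest (n : nat) (s : 'S_n) : nat :=
  #|[set p : 'I_n * 'I_n |
      [&& p.1 < p.2, p.2 <= s p.2 & s p.2 < s p.1]
      || [&& p.2 < p.1, s p.2 < p.2 & s p.1 < s p.2]]|.

(* Main.v *)
Require Import Defs.
From mathcomp Require Import all_boot all_algebra all_fingroup zify.

Import GRing.Theory Num.Theory.
Local Open Scope ring_scope.

(** Since (-1)^inv is the sign of a permutation and x^exc h^depth is the product
over i of the weights x h^(s i - i) at excedances and 1 elsewhere, the first sum
is a determinant. Its matrix has only ones on and below the diagonal, so it
factors as the full lower triangle of ones times an upper triangular matrix,
whose diagonal entries are 1 (once) and 1 - x h (n - 1 times):
[det_ones_below_diagonal].

The second identity is the first one with h replaced by - h, because
inv = depth + nest ([inversions_depth_nest]).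

For the third identity, pass to inverses: rmin becomes lmax, and excedances
become strict descents below the diagonal, v > s v; positions with v <= s v have
weight 1. [sum_lmax] shows that (-1)^lmax and (-1)^n sgn have the same weighted
sum. To see this, look for positions m < l with l <= s l and l <= s m. Exchanging
the values of s at l and m keeps both on the weight-1 side, so the weight is
unchanged and the sign flips. When l is chosen minimal, m is determined, and the
exchange also flips the parity of lmax: it decides whether l is a left-to-right
maximum and leaves all other positions alone. Hence all these permutations
cancel from both sums. In the remaining ones, every l with l <= s l cuts s into a
permutation of the positions before l and one of the positions from l on; every
other position then has exactly one larger value to its left. There
lmax + inv = n, so (-1)^lmax = (-1)^n sgn term by term ([sign_lmax_no_swap]).

The fourth identity is the third one at x = 1, read on inverses, since depth is
invariant under inversion. *)

(** * Inversions, depth and nestings *)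

Definition inv_left {n : nat} (s : 'S_n) (i : 'I_n) : nat :=
  #|[set j : 'I_n | (j < i)%N && (s i < s j)%N]|.

Definition inv_right {n : nat} (s : 'S_n) (i : 'I_n) : nat :=
  #|[set j : 'I_n | (i < j)%N && (s j < s i)%N]|.

Lemma card_set_sum (T : finType) (P : pred T) :
  #|[set x | P x]| = (\sum_x P x)%N.
Proof. by rewrite -sum1dep_card big_mkcond. Qed.

Lemma card_set_pairs (T : finType) (P : rel T) :
  #|[set p : T * T | P p.1 p.2]| = (\sum_i #|[set j | P i j]|)%N.
Proof.
rewrite -sum1dep_card -(pair_big_dep predT P (fun _ _ => 1%N)) /=.
by apply: eq_bigr => i _; rewrite sum1dep_card.
Qed.

Lemma card_set_pairs_swap (T : finType) (P : rel T) :
  #|[set p : T * T | P p.1 p.2]| = (\sum_j #|[set i | P i j]|)%N.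
Proof.
rewrite card_set_pairs.
under eq_bigr => i _ do rewrite card_set_sum.
by rewrite exchange_big; apply: eq_bigr => j _; rewrite card_set_sum.
Qed.

Lemma inversions_right (n : nat) (s : 'S_n) :
  inversions s = (\sum_i inv_right s i)%N.
Proof.
exact: (card_set_pairs _ (fun i j : 'I_n => (i < j)%N && (s j < s i)%N)).
Qed.

Lemma inversions_left (n : nat) (s : 'S_n) :
  inversions s = (\sum_i inv_left s i)%N.
Proof.
exact: (card_set_pairs_swap _ (fun i j : 'I_n => (i < j)%N && (s j < s i)%N)).
Qed.

Lemma card_ord_lt (n k : nat) : (k <= n)%N -> #|[set j : 'I_n | (j < k)%N]| = k.
Proof.
move=> le_kn; rewrite -sum1dep_card (big_ord_narrow le_kn) /=.
by rewrite sum_nat_const card_ord muln1.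
Qed.

(** Split the s i positions holding a value below s i, and the i positions before
i, according to the side of i and of s i: both contain the positions before i
with a value below s i, and removing those leaves the two inversion counts. *)
Lemma inv_right_left (n : nat) (s : 'S_n) (i : 'I_n) :
  (inv_right s i + i = inv_left s i + s i)%N.
Proof.
have si : #|[set j : 'I_n | (s j < s i)%N]| = s i.
  rewrite -[RHS](card_ord_lt n (s i)) ?(ltnW (ltn_ord _)) //.
  rewrite -[RHS](card_imset _ (@perm_inj _ s^-1%g)) -sum1dep_card -sum1_card.
  apply: eq_bigl => j; apply/idP/imsetP => [lt_j | [k]].
    by exists (s j); rewrite ?inE ?permK.
  by rewrite inE => lt_k ->; rewrite permKV.
have ii : #|[set j : 'I_n | (j < i)%N]| = i by rewrite card_ord_lt // ltnW.
suff : (inv_right s i + #|[set j : 'I_n | (j < i)%N]|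
        = inv_left s i + #|[set j : 'I_n | (s j < s i)%N]|)%N by rewrite ii si.
rewrite /inv_left /inv_right !card_set_sum -!big_split /=; apply: eq_bigr => j _.
have [eq_ij | ne_ij] := eqVneq i j; first by rewrite eq_ij !ltnn.
have : (s i : nat) != s j by rewrite (inj_eq val_inj) (inj_eq perm_inj).
have : (i : nat) != j by [].
by case: (ltngtP i j) => // _ _; case: (ltngtP (s i) (s j)).
Qed.

Lemma depth_sum_sub (n : nat) (s : 'S_n) :
  depth s = (\sum_(i < n) (s i - i))%N.
Proof.
rewrite /depth big_mkcond; apply: eq_bigr => i _.
by case: ltnP => // /eqnP ->.
Qed.

Lemma nest_sum (n : nat) (s : 'S_n) :
  nest s = (\sum_(i < n) (if (i <= s i)%N then inv_left s i else inv_right s i))%N.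
Proof.
pose P (i j : 'I_n) := [&& i < j, j <= s j & s j < s i]%N
  || [&& j < i, s j < j & s i < s j]%N.
rewrite [LHS](card_set_pairs_swap _ P); apply: eq_bigr => j _.
rewrite /inv_left /inv_right /P; case: leqP => _;
  apply: eq_card => i; rewrite !inE /=.
  by rewrite andbF orbF.
by rewrite andbF.
Qed.

(** The equality holds position by position. If i <= s i, then i contributes
s i - i to the depth and its left inversions to nest, which by [inv_right_left]
add up to its right inversions; otherwise it contributes exactly its right
inversions to nest. *)
Lemma inversions_depth_nest (n : nat) (s : 'S_n) :
  inversions s = (depth s + nest s)%N.
Proof.
rewrite inversions_right depth_sum_sub nest_sum -big_split /=.
apply: eq_bigr => i _; have := inv_right_left n s i.
by case: leqP => [le_i | lt_i] E; move: (inv_right s i) (inv_left s i) E => r l; lia.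
Qed.

(** Since s i and i have the same sum, the total ascent of s equals its total
descent, which is the total ascent of the inverse. *)
Lemma depth_inv (n : nat) (s : 'S_n) : depth s^-1 = depth s.
Proof.
rewrite !depth_sum_sub (reindex_inj (@perm_inj _ s)) /=.
under eq_bigr => i _ do rewrite permK.
apply/eqP; rewrite -(eqn_add2r (\sum_(i < n) s i)%N) -big_split /=.
have E : (\sum_(i < n) s i = \sum_(i < n) i)%N.
  by rewrite [RHS](reindex_inj (@perm_inj _ s)).
by rewrite E -big_split; apply/eqP; apply: eq_bigr => i _ /=; lia.
Qed.

Lemma rmin_inv (n : nat) (s : 'S_n) : rmin s^-1 = lmax s.
Proof.
rewrite /rmin /lmax -[RHS](card_imset _ (@perm_inj _ s)).
apply: eq_card => i; rewrite inE; apply/forallP/imsetP => [min_i | [k]].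
  exists (s^-1 i)%g; last by rewrite permKV.
  rewrite inE; apply/forallP => j; apply/implyP => lt_j.
  rewrite permKV ltnNge leq_eqVlt negb_or; apply/andP; split.
    apply: contraTneq lt_j => /val_inj ->; by rewrite permK ltnn.
  apply: contraTN lt_j => lt_i.
  by have := min_i (s j); rewrite permK lt_i /= -leqNgt => /ltnW.
rewrite inE => /forallP max_k -> j; rewrite permK; apply/implyP => lt_j.
rewrite ltnNge leq_eqVlt negb_or; apply/andP; split.
  apply: contraTneq lt_j => /val_inj <-; by rewrite permKV ltnn.
apply: contraTN lt_j => lt_i.
by have := max_k (s^-1 j)%g; rewrite permKV lt_i /= -leqNgt => /ltnW.
Qed.

(** * Signs and a determinant *)

(** Permuting the nodes 0, ..., n - 1 of a Vandermonde determinant multiplies it by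
the sign of s, while on the product of differences the permutation makes exactly
one factor negative per inversion. *)
Lemma sign_inversions (R : comNzRingType) (n : nat) (s : 'S_n) :
  (-1) ^+ s = (-1) ^+ inversions s :> R.
Proof.
(* The comparison of absolute values needs an ordered ring without zero divisors. *)
suff E : (-1) ^+ s = (-1) ^+ inversions s :> int.
  by rewrite -[LHS](rmorph_sign (intr : int -> R)) E rmorphXn rmorphN1.
pose a : 'rV[int]_n := \row_j (j : nat)%:Z.
pose b : 'rV[int]_n := \row_j (s j : nat)%:Z.
have Eb : Vandermonde n b = Vandermonde n a *m perm_mx s^-1.
  by rewrite -col_permE; apply/matrixP => i j; rewrite !mxE.
have := congr1 determinant Eb; rewrite det_mulmx det_perm odd_permV.
rewrite !det_Vandermonde.
set pb := \prod_(i < n) _; set pa := \prod_(i < n) _ => Epb.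
have pa_neq0 : pa != 0.
  apply/prodf_neq0 => i _; apply/prodf_neq0 => j lt_ij.
  by rewrite !mxE subr_eq0 eqz_nat neq_ltn lt_ij orbT.
have sgpb : pb = (-1) ^+ inversions s * `|pb|.
  rewrite inversions_right -prodrXr /pb normr_prod -big_split /=.
  apply: eq_bigr => i _; rewrite /inv_right -sum1dep_card -prodrXr.
  rewrite big_mkcondr normr_prod -big_split /=; apply: eq_bigr => j lt_ij.
  rewrite !mxE; case: ltnP => le_s; rewrite ?expr1 ?mul1r ?mulN1r.
    by rewrite ler0_norm ?opprK // subr_le0 lez_nat ltnW.
  by rewrite ger0_norm // subr_ge0 lez_nat.
have sgpa : pa = `|pa|.
  rewrite ger0_norm //; apply: prodr_ge0 => i _; apply: prodr_ge0 => j lt_ij.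
  by rewrite !mxE subr_ge0 lez_nat ltnW.
have npb : `|pb| = pa by rewrite Epb normrM normr_sign mulr1 -sgpa.
apply: (mulfI pa_neq0); rewrite -Epb sgpb npb; exact: mulrC.
Qed.

(** Subtracting from each row the previous one leaves an upper triangular matrix,
because consecutive rows agree to the left of the diagonal. *)
Lemma det_ones_below_diagonal (R : comNzRingType) (a : nat -> nat -> R) (m : nat) :
    (forall i j, (j <= i)%N -> a i j = 1) ->
  \det (\matrix_(i < m.+1, j < m.+1) a i j) = \prod_(i < m) (1 - a i i.+1).
Proof.
move=> a1; set A := \matrix_(i, j) _.
pose L : 'M[R]_m.+1 := \matrix_(i, k) (k <= i)%:R.
(* g j k is the entry in column j of the row before row k, and 0 for k = 0, so
   that the columns of M are differences that telescope under L. *)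
pose g j k := if k is k'.+1 then a k' j else 0.
pose M : 'M[R]_m.+1 := \matrix_(k, j) (g j k.+1 - g j k).
have AE : A = L *m M.
  apply/matrixP => i j; rewrite !mxE.
  under eq_bigr => k _ do rewrite !mxE mulr_natl mulrb.
  rewrite -big_mkcond (big_ord_narrow_leq (ltn_ord i : i <= m)%N) /=.
  rewrite -(big_mkord xpredT (fun k => g j k.+1 - g j k)) telescope_sumr //=.
  by rewrite subr0.
have detL : \det L = 1.
  rewrite det_trig; first by apply: big1 => i _; rewrite mxE leqnn.
  by apply/is_trig_mxP => i j lt_ij; rewrite mxE leqNgt lt_ij.
rewrite AE det_mulmx detL mul1r -det_tr det_trig; last first.
  apply/is_trig_mxP => j k lt_jk; rewrite !mxE.
  case: (nat_of_ord k) lt_jk => [|k'] //= le_jk.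
  by rewrite !a1 ?subrr // ltnW.
rewrite big_ord_recl !mxE /= a1 // subr0 mul1r.
by apply: eq_bigr => i _; rewrite !mxE /= a1.
Qed.

(** The pairing of s with tperm x y * s matches even with odd permutations; knowing
that the sum is its own opposite would not suffice, as 2 may be a zero divisor in R. *)
Lemma sum_cancel_tperm (R : comNzRingType) (T : finType) (x y : T)
    (P : pred {perm T}) (f : {perm T} -> R) :
    x != y ->
    (forall s, P s -> P (tperm x y * s)%g) ->
    (forall s, P s -> f (tperm x y * s)%g = - f s) ->
  \sum_(s | P s) f s = 0.
Proof.
move=> ne_xy stabP fN.
have stabP' s : P (tperm x y * s)%g = P s.
  apply/idP/idP; last exact: stabP.
  by move/stabP; rewrite mulgA tperm2 mul1g.
rewrite (bigID (fun s : {perm T} => odd_perm s)) /=.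
rewrite (reindex_inj (mulgI (tperm x y))) /=.
under eq_bigl => s do rewrite stabP' odd_mul_tperm ne_xy addTb.
by rewrite -big_split /=; apply: big1 => s /andP[Ps _]; rewrite fN // addNr.
Qed.

(** * Exchanging values at a minimal overlap *)

Definition overlapped {n : nat} (s : 'S_n) (l : 'I_n) : bool :=
  (l <= s l)%N && [exists m : 'I_n, (m < l)%N && (l <= s m)%N].

(** The pair p is (l, m): l is the smallest overlapped position, and m is the
position that overlaps it. *)
Definition swappable {n : nat} (s : 'S_n) (p : 'I_n * 'I_n) : bool :=
  [&& (p.1 <= s p.1)%N, (p.2 < p.1)%N, (p.1 <= s p.2)%N
    & [forall l : 'I_n, (l < p.1)%N ==> ~~ overlapped s l]].

(** Two positions before l with values at least l would make the larger of them
overlapped by the smaller, against the minimality of l. *)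
Lemma swappable_unique {n : nat} {s : 'S_n} {l m : 'I_n} (u : 'I_n) :
  swappable s (l, m) -> (u < l)%N -> (l <= s u)%N -> u = m.
Proof.
move=> sw; have /and4P[/= le_l lt_ml le_m /forallP min_l] := sw.
have Noverlap (u1 u2 : 'I_n) :
    (u1 < u2 < l)%N -> (l <= s u1)%N -> (l <= s u2)%N -> False.
  case/andP=> lt12 lt2l le1 le2.
  have := min_l u2; rewrite lt2l /overlapped.
  rewrite (leq_trans (ltnW lt2l) le2) /=; move/existsP; case; exists u1.
  by rewrite lt12 (leq_trans (ltnW lt2l) le1).
move=> lt_ul le_u; apply/val_inj; case: (ltngtP u m) => //= lt_um.
  by case: (Noverlap u m); rewrite ?lt_um.
by case: (Noverlap m u); rewrite ?lt_um.
Qed.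

(** The exchange is invisible to comparisons with thresholds up to l, since both
exchanged values are at least l. *)
Lemma tperm_leq {n : nat} {s : 'S_n} {l m : 'I_n} (v : 'I_n) (k : nat) :
    swappable s (l, m) -> (v <= l)%N -> (k <= l)%N ->
  (k <= (tperm l m * s)%g v)%N = (k <= s v)%N.
Proof.
move=> sw; have /and4P[/= le_l lt_ml le_m _] := sw.
rewrite permM => _ le_kl; case: tpermP => // ->.
  by rewrite !(leq_trans le_kl).
by rewrite !(leq_trans le_kl).
Qed.

Lemma overlapped_tperm {n : nat} {s : 'S_n} {l m : 'I_n} (k : 'I_n) :
    swappable s (l, m) -> (k <= l)%N ->
  overlapped (tperm l m * s)%g k = overlapped s k.
Proof.
move=> sw le_kl; rewrite /overlapped tperm_leq //; congr andb.
apply: eq_existsb => u; have [lt_uk /=|//] := boolP (u < k)%N.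
by rewrite tperm_leq // (leq_trans (ltnW lt_uk)).
Qed.

Lemma swappable_tperm {n : nat} {s : 'S_n} {l m : 'I_n} :
  swappable s (l, m) -> swappable (tperm l m * s)%g =1 swappable s.
Proof.
move=> sw; have /and4P[/= le_l lt_ml le_m /forallP min_l] := sw.
have over_l : overlapped s l.
  by rewrite /overlapped le_l; apply/existsP; exists m; rewrite lt_ml.
case=> l' m'; rewrite /swappable /=; case: (leqP l' l) => [le_l'l | lt_ll'].
  rewrite tperm_leq //; congr andb; case: ltnP => //= lt_m'l'.
  rewrite tperm_leq ?(leq_trans (ltnW lt_m'l')) //; congr andb.
  apply: eq_forallb => k; case: ltnP => //= lt_kl'.
  by rewrite overlapped_tperm // ltnW // (leq_trans lt_kl').
have Nmin (r : 'S_n) : overlapped r l ->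
    [forall k : 'I_n, (k < l')%N ==> ~~ overlapped r k] = false.
  by move=> over_rl; apply/negbTE/forallPn; exists l; rewrite lt_ll' over_rl.
by rewrite !Nmin ?overlapped_tperm // !andbF.
Qed.

Definition is_lmax {n : nat} (s : 'S_n) (v : 'I_n) : bool :=
  [forall u : 'I_n, (u < v)%N ==> (s u < s v)%N].

(** Among the values before l, only the one at m can reach l <= s l. *)
Lemma is_lmax_swap_top {n : nat} {s : 'S_n} {l m : 'I_n} :
  swappable s (l, m) -> is_lmax s l = (s m < s l)%N.
Proof.
move=> sw; have /and4P[/= le_l lt_ml le_m _] := sw.
apply/forallP/idP => [/(_ m)|lt_s u]; first by rewrite lt_ml.
apply/implyP => lt_ul; have [->//|ne_um] := eqVneq u m.
apply: leq_trans le_l; rewrite ltnNge; apply: contraNN ne_um => le_u.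
exact/eqP/(swappable_unique _ sw).
Qed.

(** Before l, the value at m is the only one that is at least l. *)
Lemma is_lmax_swap_before {n : nat} {s : 'S_n} {l m : 'I_n} (v : 'I_n) :
  swappable s (l, m) -> (m <= v < l)%N -> is_lmax s v = (v == m).
Proof.
move=> sw; have /and4P[/= le_l lt_ml le_m _] := sw.
have small (u : 'I_n) : (u < l)%N -> u != m -> (s u < l)%N.
  move=> lt_ul; apply: contraNT; rewrite -leqNgt => le_u.
  exact/eqP/(swappable_unique _ sw).
case/andP=> le_mv lt_vl; have [->|ne_vm] := eqVneq v m; apply/forallP.
  move=> u; apply/implyP => lt_um; apply: leq_trans le_m.
  apply: small; first exact: ltn_trans lt_um lt_ml.
  by apply: contraTneq lt_um => ->; rewrite ltnn.
move/(_ m); rewrite ltn_neqAle le_mv eq_sym ne_vm /=.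
by apply/negP; rewrite -leqNgt (leq_trans _ le_m) // ltnW // small.
Qed.

(** Before m nothing changes, from m to l the maxima are known in both
permutations, and after l the same set of values is seen to the left. *)
Lemma is_lmax_tperm (n : nat) (s : 'S_n) (l m v : 'I_n) :
  swappable s (l, m) ->
  is_lmax (tperm l m * s)%g v = (v == l) (+) is_lmax s v.
Proof.
move=> sw; have sw' : swappable (tperm l m * s)%g (l, m).
  by rewrite (swappable_tperm sw).
have /and4P[/= _ lt_ml _ _] := sw.
have [->|ne_vl /=] := eqVneq v l.
  rewrite (is_lmax_swap_top sw') (is_lmax_swap_top sw).
  have : (s m : nat) != s l.
    by rewrite (inj_eq val_inj) (inj_eq perm_inj) -(inj_eq val_inj) ltn_eqF.
  by rewrite !permM tpermL tpermR; case: ltngtP.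
have [lt_vm | le_mv] := ltnP v m.
  have fix_le (u : 'I_n) : (u <= v)%N -> (tperm l m * s)%g u = s u.
    move=> le_uv; have lt_um := leq_ltn_trans le_uv lt_vm.
    by rewrite permM tpermD // -(inj_eq val_inj) gtn_eqF // (ltn_trans lt_um).
  apply: eq_forallb => u; case: ltnP => //= lt_uv.
  by rewrite !fix_le // ltnW.
have [lt_vl | le_lv] := ltnP v l.
  by rewrite (is_lmax_swap_before _ sw') ?(is_lmax_swap_before _ sw) ?le_mv.
have {ne_vl le_lv} lt_lv : (l < v)%N by rewrite ltn_neqAle eq_sym ne_vl.
have lt_mv := ltn_trans lt_ml lt_lv.
have stab (r : 'S_n) : is_lmax r v -> is_lmax (tperm l m * r)%g v.
  move/forallP => max_v; apply/forallP => u; apply/implyP => lt_uv.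
  rewrite !permM [tperm l m v]tpermD ?(implyP (max_v _)) //.
  - by case: tpermP.
  - by rewrite -(inj_eq val_inj) ltn_eqF.
  - by rewrite -(inj_eq val_inj) ltn_eqF.
by apply/idP/idP => [/stab|/stab//]; rewrite mulgA tperm2 mul1g.
Qed.

Lemma sign_lmax (R : comNzRingType) (n : nat) (s : 'S_n) :
  (-1) ^+ lmax s = \prod_v (-1) ^+ is_lmax s v :> R.
Proof. by rewrite /lmax card_set_sum prodrXr. Qed.

Lemma sign_lmax_tperm (R : comNzRingType) (n : nat) (s : 'S_n) (l m : 'I_n) :
  swappable s (l, m) -> (-1) ^+ lmax (tperm l m * s)%g = - (-1) ^+ lmax s :> R.
Proof.
move=> sw; rewrite !sign_lmax (bigD1 l) //= [in RHS](bigD1 l) //= -mulNr.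
rewrite is_lmax_tperm // eqxx signr_addb expr1 mulN1r; congr (_ * _).
by apply: eq_bigr => v /negbTE ne_vl; rewrite is_lmax_tperm // ne_vl.
Qed.

(** * Permutations without overlaps *)

Lemma is_lmax_inv_left (n : nat) (s : 'S_n) (v : 'I_n) :
  is_lmax s v = (inv_left s v == 0)%N.
Proof.
rewrite cards_eq0; apply/forallP/eqP => [max_v | no_inv u].
  apply/setP => u; rewrite !inE; apply/negbTE.
  by rewrite negb_and -implybE -leqNgt; apply/implyP => /(implyP (max_v u))/ltnW.
apply/implyP => lt_uv; move/setP/(_ u): no_inv; rewrite !inE lt_uv /=.
move/negbT; rewrite -leqNgt leq_eqVlt => /orP[/eqP/val_inj/perm_inj E|//].
by rewrite E ltnn in lt_uv.
Qed.

Lemma not_overlapped {n : nat} {s : 'S_n} (l : 'I_n) :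
  (forall p, ~~ swappable s p) -> ~~ overlapped s l.
Proof.
move=> no_swap; apply/negP => over_l.
case: (arg_minnP (fun i : 'I_n => i : nat) over_l) => k.
case/andP=> le_k /existsP[m /andP[lt_mk le_m]] min_k.
have /negP := no_swap (k, m); apply.
rewrite /swappable /= le_k lt_mk le_m; apply/forallP => i; apply/implyP => lt_ik.
by apply: contraTN lt_ik => /min_k; rewrite -leqNgt.
Qed.

(** Absence of overlaps sends the positions before l into themselves, hence onto
themselves by finiteness. *)
Lemma stable_below {n : nat} {s : 'S_n} (l u : 'I_n) :
  (forall p, ~~ swappable s p) -> (l <= s l)%N -> (s u < l)%N = (u < l)%N.
Proof.
move=> no_swap le_l; set A := [set v : 'I_n | (v < l)%N].
have subA (v : 'I_n) : (v < l)%N -> (s v < l)%N.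
  move=> lt_vl; have := not_overlapped l no_swap; rewrite /overlapped le_l /=.
  by apply: contraR; rewrite -leqNgt => le_v; apply/existsP; exists v; rewrite lt_vl.
have imA : s @: A = A.
  apply/eqP; rewrite eqEcard card_imset ?leqnn ?andbT; last exact: perm_inj.
  by apply/subsetP => _ /imsetP[v + ->]; rewrite !inE; apply: subA.
have -> : (u < l)%N = (u \in A) by rewrite inE.
by rewrite -(mem_imset _ _ (@perm_inj _ s)) imA inE.
Qed.

(** At most one position crosses the cut c downwards. When the cut moves past c,
either c <= s c, and nothing crossed before, so only the preimage of c can cross
now; or c itself was the one crossing, and only the preimage of c replaces it. *)
Lemma descent_across_unique {n : nat} {s : 'S_n} (c : nat) (u v : 'I_n) :
    (forall p, ~~ swappable s p) ->
  (c <= u)%N -> (c <= v)%N -> (s u < c)%N -> (s v < c)%N -> u = v.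
Proof.
move=> no_swap; elim: c u v => // c IHc u v lt_cu lt_cv; rewrite !ltnS => le_u le_v.
pose k := Ordinal (ltn_trans lt_cu (ltn_ord u)).
have [le_k | lt_k] := leqP k (s k).
  have ge (w : 'I_n) : (c < w)%N -> (c <= s w)%N.
    by move=> lt_cw; rewrite -[c]/(k : nat) leqNgt stable_below // -leqNgt ltnW.
  apply/(@perm_inj _ s)/val_inj/eqP; rewrite eqn_leq.
  by rewrite (leq_trans le_u (ge _ lt_cv)) (leq_trans le_v (ge _ lt_cu)).
have hits (w : 'I_n) : (c < w)%N -> (s w <= c)%N -> s w = k.
  move=> lt_cw; rewrite leq_eqVlt => /orP[/eqP E|lt_w]; first exact: val_inj.
  have E : k = w by apply: IHc => //; apply: ltnW.
  by rewrite -E /= ltnn in lt_cw.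
by apply: (@perm_inj _ s); rewrite (hits u lt_cu le_u) (hits v lt_cv le_v).
Qed.

(** At most one position crosses the cut c upwards: when the cut moves past c, a
new crossing can only start at c, and this requires c <= s c, in which case
nothing crossed before. *)
Lemma ascent_across_unique {n : nat} {s : 'S_n} (c : nat) (u v : 'I_n) :
    (forall p, ~~ swappable s p) ->
  (u < c)%N -> (v < c)%N -> (c <= s u)%N -> (c <= s v)%N -> u = v.
Proof.
move=> no_swap; elim: c u v => // c IHc u v; rewrite !ltnS => le_uc le_vc lt_u lt_v.
pose k := Ordinal (ltn_trans lt_u (ltn_ord (s u))).
have [le_k | lt_k] := leqP k (s k).
  have eqc (w : 'I_n) : (w <= c)%N -> (c < s w)%N -> w = k.
    move=> le_wc lt_w; apply/val_inj/eqP; rewrite eqn_leq le_wc leqNgt.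
    by rewrite -(stable_below k w no_swap le_k) -leqNgt ltnW.
  by rewrite (eqc u le_uc lt_u) (eqc v le_vc lt_v).
have ltc (w : 'I_n) : (w <= c)%N -> (c < s w)%N -> (w < c)%N.
  move=> le_wc lt_w; rewrite ltn_neqAle le_wc andbT.
  apply: contraTneq lt_w => E; have -> : w = k by apply: val_inj.
  by rewrite -leqNgt ltnW.
by apply: IHc; rewrite ?ltc // ltnW.
Qed.

(** A larger value s w > s v to the left of v must be at least v, so that w crosses
the cut v upwards. Otherwise the cut at s w is crossed downwards by v: this is
impossible if s w <= s (s w), and else s w itself
crosses it too, which would make s w equal to v. *)
Lemma inv_left_le1 {n : nat} {s : 'S_n} (v : 'I_n) :
  (forall p, ~~ swappable s p) -> (inv_left s v <= 1)%N.
Proof.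
move=> no_swap; apply/card_le1_eqP => u u'.
suff across (w : 'I_n) : w \in [set j : 'I_n | (j < v)%N && (s v < s j)%N] ->
    (w < v)%N /\ (v <= s w)%N.
  move=> /across[lt_u le_u] /across[lt_u' le_u'].
  exact: (ascent_across_unique v).
rewrite inE => /andP[lt_wv lt_s]; split=> //; rewrite leqNgt.
apply/negP => lt_swv; have [le_k | lt_k] := leqP (s w) (s (s w)).
  by move: lt_s; rewrite stable_below // ltnNge ltnW.
have E : s w = v by apply: (descent_across_unique (s w)) => //; apply: ltnW.
by rewrite E ltnn in lt_swv.
Qed.

(** Each position is either a left-to-right maximum, or has exactly one larger
value to its left. *)
Lemma sign_lmax_no_swap (R : comNzRingType) {n : nat} {s : 'S_n} :
    (forall p, ~~ swappable s p) ->
  (-1) ^+ lmax s = (-1) ^+ n * (-1) ^+ s :> R.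
Proof.
move=> no_swap; suff E : (n = lmax s + inversions s)%N.
  by rewrite sign_inversions {2}E exprD -mulrA -expr2 sqrr_sign mulr1.
rewrite inversions_left /lmax card_set_sum -big_split /= -[LHS]card_ord -sum1_card.
apply: eq_bigr => v _; rewrite -/(is_lmax s v) is_lmax_inv_left.
by case: (inv_left s v) (inv_left_le1 v no_swap) => [|[]].
Qed.

(** * The identities *)

(** The exchange at the minimal overlap cancels the difference of the two sides; it
preserves the products because it only involves entries with a i j = 1. *)
Lemma sum_lmax (R : comNzRingType) (a : nat -> nat -> R) (n : nat) :
    (forall i j, (j <= i)%N -> a i j = 1) ->
  \sum_(s : 'S_n) (-1) ^+ lmax s * \prod_v a (s v) v
    = (-1) ^+ n * \sum_(s : 'S_n) (-1) ^+ s * \prod_v a (s v) v.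
Proof.
move=> a1; apply/eqP; rewrite -subr_eq0 mulr_sumr -sumrB.
under eq_bigr => s _ do rewrite mulrA -mulrBl.
(* Picking a swappable pair gives an invariant of the exchange by
   [swappable_tperm], because the pick depends only on the set of such pairs. *)
apply/eqP.
rewrite (partition_big (fun s : 'S_n => [pick p | swappable s p]) predT) //=.
apply: big1 => -[[l m]|] _; last first.
  apply: big1 => s /eqP; case: pickP => // no_sw _.
  by rewrite sign_lmax_no_swap ?subrr ?mul0r // => p; rewrite no_sw.
have picked (s : 'S_n) :
    [pick p | swappable s p] == Some (l, m) -> swappable s (l, m).
  by case: pickP => // p sw /eqP[<-].
have [eq_lm | ne_lm] := eqVneq l m.
  by apply: big1 => s /picked; rewrite eq_lm /swappable ltnn andbF.
apply: (sum_cancel_tperm _ _ l m) => // s /[dup] pick_s /picked sw.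
  by rewrite (eq_pick (swappable_tperm sw)).
have -> : \prod_v a ((tperm l m * s)%g v) v = \prod_v a (s v) v.
  have /and4P[/= le_l lt_ml le_m _] := sw.
  apply: eq_bigr => v _; rewrite permM; case: tpermP => // ->.
    by rewrite !a1.
  by rewrite !a1 // (leq_trans (ltnW lt_ml)).
rewrite sign_lmax_tperm // odd_mul_tperm ne_lm signr_addb expr1 mulN1r.
by rewrite mulrN opprK -[RHS]mulNr opprB addrC.
Qed.

Definition weight (R : comNzRingType) (x h : R) (i j : nat) : R :=
  if (i < j)%N then x * h ^+ (j - i) else 1.

Lemma prod_weight (R : comNzRingType) (x h : R) (n : nat) (s : 'S_n) :
  \prod_(i < n) weight R x h i (s i) = x ^+ exc s * h ^+ depth s.
Proof.
rewrite /exc card_set_sum /depth -!prodrXr [X in _ * X]big_mkcond -big_split /=.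
apply: eq_bigr => i _; rewrite /weight; case: ltnP => // _.
by rewrite !expr0 mulr1.
Qed.

Lemma det_weight (R : comNzRingType) (x h : R) (m : nat) :
  \sum_(s : 'S_m.+1) (-1) ^+ s * \prod_(i < m.+1) weight R x h i (s i)
    = (1 - x * h) ^+ m.
Proof.
transitivity (\det (\matrix_(i < m.+1, j < m.+1) weight R x h i j)).
  apply: eq_bigr => s _; congr (_ * _).
  by apply: eq_bigr => i _; rewrite mxE.
rewrite det_ones_below_diagonal => [|i j le_ji]; last first.
  by rewrite /weight ltnNge le_ji.
rewrite -[in RHS](card_ord m) -prodr_const; apply: eq_bigr => i _.
by rewrite /weight ltnSn subSnn expr1.
Qed.

Theorem proposition8p1 (R : comNzRingType) (x h : R) (n : nat) (n_ge1 : (1 <= n)%N) :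
  [/\ \sum_(s : 'S_n) (-1) ^+ inversions s * x ^+ exc s * h ^+ depth s
        = (1 - x * h) ^+ (n - 1),
      \sum_(s : 'S_n) (-1) ^+ nest s * x ^+ exc s * h ^+ depth s
        = (1 + x * h) ^+ (n - 1),
      \sum_(s : 'S_n) (-1) ^+ rmin s * x ^+ exc s * h ^+ depth s
        = (-1) ^+ n * (1 - x * h) ^+ (n - 1)
    & \sum_(s : 'S_n) (-1) ^+ lmax s * h ^+ depth s
        = (-1) ^+ n * (1 - h) ^+ (n - 1)].
Proof.
case: n n_ge1 => // m _; rewrite subn1 /=.
have sum_inv (y k : R) : \sum_(s : 'S_m.+1) (-1) ^+ inversions s * y ^+ exc s
    * k ^+ depth s = (1 - y * k) ^+ m.
  rewrite -det_weight; apply: eq_bigr => s _.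
  by rewrite sign_inversions prod_weight mulrA.
(* The variable y is instantiated at x for rmin, and at 1 for lmax. *)
have sum_rmin (y : R) : \sum_(s : 'S_m.+1) (-1) ^+ rmin s * y ^+ exc s
    * h ^+ depth s = (-1) ^+ m.+1 * (1 - y * h) ^+ m.
  have prod_weight_inv (s : 'S_m.+1) :
      \prod_(v < m.+1) weight R y h (s v) v
        = \prod_(i < m.+1) weight R y h i ((s^-1)%g i).
    rewrite [RHS](reindex_inj (@perm_inj _ s)).
    by apply: eq_bigr => v _; rewrite permK.
  rewrite (reindex_inj invg_inj) /=.
  under eq_bigr => s _ do rewrite rmin_inv -mulrA -prod_weight -prod_weight_inv.
  rewrite sum_lmax; last by move=> i j le_ji; rewrite /weight ltnNge le_ji.
  congr (_ * _); rewrite -det_weight [RHS](reindex_inj invg_inj) /=.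
  by apply: eq_bigr => s _; rewrite odd_permV prod_weight_inv.
split=> //.
- rewrite -[x * h]opprK -mulrN -sum_inv; apply: eq_bigr => s _.
  rewrite inversions_depth_nest exprD [(- h) ^+ _]exprNn.
  rewrite [_ * (-1) ^+ nest s]mulrC -!mulrA; congr (_ * _).
  by rewrite [RHS]mulrCA; congr (_ * _); rewrite mulrA -expr2 sqrr_sign mul1r.
- have := sum_rmin 1; rewrite mul1r => <-; rewrite [RHS](reindex_inj invg_inj).
  by apply: eq_bigr => s _; rewrite expr1n mulr1 rmin_inv depth_inv.
Qed.
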